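(* Let $\otimes$ be a merge on $\mathbb{S}$. Then $(\mathcal{R},\eta^{\mathcal{R}},(\cdot)^{\mathcal{R}})$ is a Kleisli triple over the category of sets, and hence a monad.
   Context: $\mathbb{S}$ is the set of states: finite sets $s$ of triples $\langle P,\vec m,n\rangle$ ($P$ a $(k+1)$-ary primitive recursive predicate symbol, $\vec m\in\mathbb{N}^k$, $n\in\mathbb{N}$) with $P(\vec m,n)$ true in the standard model and at most one $n$ for each $(P,\vec m)$; $\bot=\emptyset$. For a set $X$, $\mathcal{S}X$ is the set of functions $\mathbb{S}\to X$; for $g:X\to\mathcal{S}Y$ put $g^{*}:\mathcal{S}X\to\mathcal{S}Y$, $g^{*}(\alpha)=\lambda s.\,g(\alpha(s))(s)$. A merge is a map $\otimes:\mathbb{S}\times\mathbb{S}\to\mathbb{S}$ such that $(\mathbb{S},\otimes,\bot)$ is a monoid, $s_1\otimes s_2=\bot$ implies $s_1=s_2=\bot$, and $s_1\otimes s_2\subseteq s_1\cup s_2$. Its pointwise lifting is $\otimes^{\mathcal{S}}$ on $\mathcal{S}\mathbb{S}$: $(r\otimes^{\mathcal{S}}r')(s)=r(s)\otimes r'(s)$. Define $\mathcal{R}X=\mathcal{S}X\times\mathcal{S}\mathbb{S}$, $\eta^{\mathcal{R}}_X(x)=(\lambda\_.x,\lambda\_.\bot)$, and for $f:X\to\mathcal{R}Y$ with components $f_1=\pi_1\circ f:X\to\mathcal{S}Y$, $f_2=\pi_2\circ f:X\to\mathcal{S}\mathbb{S}$, put $f^{\mathcal{R}}(\alpha,r)=(f_1^{*}(\alpha),\,r\otimes^{\mathcal{S}}f_2^{*}(\alpha))$.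 A Kleisli triple $(T,\eta,(\cdot)^\dagger)$ over sets consists of an assignment $X\mapsto TX$, maps $\eta_X:X\to TX$, and for each $f:X\to TY$ a map $f^\dagger:TX\to TY$ with $f^\dagger\circ\eta_X=f$, $\eta_X^\dagger=\mathrm{id}_{TX}$, and $g^\dagger\circ f^\dagger=(g^\dagger\circ f)^\dagger$ for $g:Y\to TZ$. *)

(* Defs.v *)
From HB Require Import structures.
From mathcomp Require Import all_boot finmap boolp.

Set Implicit Arguments.
Unset Strict Implicit.
Unset Printing Implicit Defensive.

(* [PRec f g] recurses on its first argument:
   (0, v) |-> f v   and   (n + 1, v) |-> g (n, h (n, v), v). *)
Inductive primrec : nat -> Type :=
| PZero : primrec 0
| PSucc : primrec 1
| PProj k (i : 'I_k) : primrec k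
| PComp k l (f : primrec l) (g : 'I_l -> primrec k) : primrec k
| PRec k (f : primrec k) (g : primrec k.+2) : primrec k.+1.

Fixpoint eval k (p : primrec k) : k.-tuple nat -> nat :=
  match p in primrec k return k.-tuple nat -> nat with
  | PZero => fun _ => 0
  | PSucc => fun v => (thead v).+1
  | PProj _ i => fun v => tnth v i
  | PComp _ _ f g => fun v => eval f [tuple eval (g i) v | i < _]
  | PRec _ f g => fun v =>
      nat_rect (fun=> nat) (eval f [tuple of behead v])
        (fun n r => eval g [tuple of n :: r :: behead v]) (thead v)
  end.

(* A primitive recursive predicate symbol is given by a primitive recursive
   function symbol, read as a characteristic function: it holds at [v] iff
   its value there is nonzero. *)
Definition predsym (k : nat) := primrec k.

Definition holds k (P : predsym k) (v : k.-tuple nat) : bool := eval P v != 0.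

(* The triples <P, m, n>, not required to be true. *)
Record triple := Triple {
  triple_arity : nat;
  triple_pred : predsym triple_arity.+1;
  triple_args : triple_arity.-tuple nat;
  triple_val : nat }.

(* [{fset triple}] needs a choiceType; the classical one is used. *)
HB.instance Definition _ := gen_eqMixin triple.
HB.instance Definition _ := gen_choiceMixin triple.

Record state := State {
  state_fset :> {fset triple};
  state_true : forall k (P : predsym k.+1) (m : k.-tuple nat) (n : nat),
    Triple P m n \in state_fset -> holds P [tuple of rcons m n];
  state_uniq : forall k (P : predsym k.+1) (m : k.-tuple nat) (n n' : nat),
    Triple P m n \in state_fset -> Triple P m n' \in state_fset -> n = n' }.

Program Definition bot : state := @State fset0 _ _.

Record is_merge (op : state -> state -> state) : Prop := IsMerge {
  merge_assoc : associative op;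
  merge_botl : left_id bot op;
  merge_botr : right_id bot op;
  merge_eq_bot : forall s1 s2, op s1 s2 = bot -> s1 = bot /\ s2 = bot;
  merge_sub : forall s1 s2, (op s1 s2 `<=` s1 `|` s2)%fset }.

Definition St (X : Type) : Type := state -> X.

Definition star (X Y : Type) (g : X -> St Y) : St X -> St Y :=
  fun alpha s => g (alpha s) s.

Definition merge_lift (op : state -> state -> state) (r r' : St state) :
  St state := fun s => op (r s) (r' s).

Definition Rl (X : Type) : Type := St X * St state.

Definition etaR (X : Type) (x : X) : Rl X := (fun=> x, fun=> bot).

Definition extR (op : state -> state -> state) (X Y : Type) (f : X -> Rl Y) :
    Rl X -> Rl Y :=
  fun ar => (star (fst \o f) ar.1, merge_lift op ar.2 (star (snd \o f) ar.1)).

Record is_kleisli_triple (T : Type -> Type) (eta : forall X, X -> T X)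
    (ext : forall X Y, (X -> T Y) -> T X -> T Y) : Prop := IsKleisliTriple {
  kleisli_ext_eta : forall X Y (f : X -> T Y), ext X Y f \o @eta X = f;
  kleisli_eta_ext : forall X, ext X X (@eta X) = id;
  kleisli_ext_comp : forall X Y Z (f : X -> T Y) (g : Y -> T Z),
    ext Y Z g \o ext X Y f = ext X Z (ext Y Z g \o f) }.

(* [T] with [fmap] is an endofunctor of the category of types and functions,
   [eta] and [mu] are natural, and the monad diagrams commute. *)
Record is_monad (T : Type -> Type)
    (fmap : forall X Y, (X -> Y) -> T X -> T Y)
    (eta : forall X, X -> T X) (mu : forall X, T (T X) -> T X) : Prop :=
  IsMonad {
  monad_fmap_id : forall X, fmap X X id = id;
  monad_fmap_comp : forall X Y Z (f : X -> Y) (g : Y -> Z),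
    fmap X Z (g \o f) = fmap Y Z g \o fmap X Y f;
  monad_eta_nat : forall X Y (f : X -> Y),
    fmap X Y f \o @eta X = @eta Y \o f;
  monad_mu_nat : forall X Y (f : X -> Y),
    fmap X Y f \o @mu X = @mu Y \o fmap (T X) (T Y) (fmap X Y f);
  monad_mu_etal : forall X, @mu X \o @eta (T X) = id;
  monad_mu_etar : forall X, @mu X \o fmap X (T X) (@eta X) = id;
  monad_mu_assoc : forall X, @mu X \o @mu (T X) = @mu X \o fmap _ _ (@mu X) }.

Definition kleisli_fmap (T : Type -> Type) (eta : forall X, X -> T X)
    (ext : forall X Y, (X -> T Y) -> T X -> T Y) (X Y : Type) (f : X -> Y) :
    T X -> T Y := ext X Y (@eta Y \o f).

Definition kleisli_mu (T : Type -> Type)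
    (ext : forall X Y, (X -> T Y) -> T X -> T Y) (X : Type) :
    T (T X) -> T X := ext (T X) X id.

(* Main.v *)
Require Import Defs.
From mathcomp Require Import all_boot finmap boolp.

(** [Rl] pairs the reader monad over [state] with a log valued in the monoid [(state, op, bot)],
    itself read at the current state. Values obey the reader laws by conversion; logs obey the
    monoid laws pointwise. Any Kleisli triple then yields a monad. *)

Lemma kleisli_ext_fmap (T : Type -> Type) (eta : forall X, X -> T X)
    (ext : forall X Y, (X -> T Y) -> T X -> T Y) :
  is_kleisli_triple eta ext ->
  forall X Y Z (f : X -> Y) (g : Y -> T Z),
  ext Y Z g \o kleisli_fmap eta ext f = ext X Z (g \o f).
Proof.
case=> ext_eta _ ext_comp X Y Z f g.
by rewrite /kleisli_fmap ext_comp compA ext_eta.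
Qed.

(** Fusing [ext] with [kleisli_fmap] turns composites into a single [ext], leaving only Kleisli
    laws. *)
Lemma kleisli_triple_is_monad (T : Type -> Type) (eta : forall X, X -> T X)
    (ext : forall X Y, (X -> T Y) -> T X -> T Y) :
  is_kleisli_triple eta ext ->
  is_monad (kleisli_fmap eta ext) eta (kleisli_mu ext).
Proof.
move=> K; have ext_fmap := kleisli_ext_fmap _ _ _ K.
case: K => ext_eta eta_ext ext_comp.
split=> [X|X Y Z f g|X Y f|X Y f|X|X|X].
- exact: eta_ext.
- by rewrite {2}/kleisli_fmap ext_fmap.
- exact: ext_eta.
- by rewrite /kleisli_mu ext_fmap {1}/kleisli_fmap ext_comp.
- exact: ext_eta.
- by rewrite /kleisli_mu ext_fmap; exact: eta_ext.
- by rewrite /kleisli_mu ext_fmap ext_comp.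
Qed.

(* The three laws come down to the left unit, right unit and associativity
   laws of [(state, op, bot)], evaluated at each state. *)
Lemma extR_is_kleisli_triple (op : state -> state -> state) :
  associative op -> left_id bot op -> right_id bot op ->
  is_kleisli_triple etaR (extR op).
Proof.
move=> opA op0s ops0; split=> [X Y f|X|X Y Z f g]; apply/funext.
(* In all three laws [congr pair] closes the value component by conversion; only the log remains. *)
- move=> x /=; rewrite [RHS]surjective_pairing; congr pair.
  by apply/funext => s; exact: op0s.
- move=> [a r]; congr pair.
  by apply/funext => s; exact: ops0.
- move=> [a r]; congr pair.
  by apply/funext => s; rewrite /merge_lift /= -opA.
Qed.

Theorem theorem5p7 (op : state -> state -> state) (op_merge : is_merge op) :
  is_kleisli_triple etaR (extR op) /\
  is_monad (kleisli_fmap etaR (extR op)) etaR (kleisli_mu (extR op)).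
Proof.
have K : is_kleisli_triple etaR (extR op).
  by case: op_merge => opA op0s ops0 _ _; exact: extR_is_kleisli_triple.
by split; last exact: kleisli_triple_is_monad.
Qed.
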